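(* Let $(N,g)$, $N=(0,\tau_{\max})\times M$, $g=-dt^2+h$, be a cosmological spacetime with compact slices such that $h$ extends continuously to $t=0$ and $t=\tau_{\max}$ as a Riemannian metric. Then its associated timed metric space $(\bar N,\hat d,\tau)$, where $\tau$ is the continuous extension of $t$, is causally-null, i.e. $\hat d_{\hat d,\tau}=\hat d$ on $\bar N$.
   Context: A spacetime is a connected smooth time-oriented Lorentzian manifold of signature $(-,+,\dots,+)$. A vector $v$ is causal if $v\ne0$ and $g(v,v)\le0$. A cosmological spacetime is a spacetime $N=(0,\tau_{\max})\times M$ with metric $g=-dt^2+h$, where $h$ is a smooth symmetric 2-tensor on $N$ whose radical is spanned by $\partial_t$; each restriction $h_t=h|_{\{t\}\times M}$ is then a Riemannian metric on $M$; $N$ is time-oriented by $\partial_t$. Compact slices means $M$ compact. ''$h$ extends continuously to $t=0$ and $t=\tau_{\max}$ as a Riemannian metric'' means that $h_t$ extends continuously in $(t,x)$ to $t\in[0,\tau_{\max}]$ with $h_0,h_{\tau_{\max}}$ Riemannian. A piecewise causal curve is a continuous curve $\alpha:[a,b]\to N$ with a partition $a=s_0<\dots<s_n=b$ such that each $\alpha|_{(s_{i-1},s_i)}$ is smooth causal (future or past directed). Its null length is $\hat L(\alpha)=\sum_i|t(\alpha(s_i))-t(\alpha(s_{i-1}))|$, and the null distance $\hat d(p,q)$ is the infimum of $\hat L$ over piecewise causal curves from $p$ to $q$. The associated timed metric space is the metric completion $(\bar N,\hat d)$ of $(N,\hat d)$ with the continuous extension $\tau$ of $t$ (the cosmological time).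 For a timed metric space $(X,d,\tau)$ (a metric space with a 1-Lipschitz function $\tau:X\to[0,\infty)$), define $p\le_{d,\tau}q\iff d(p,q)=\tau(q)-\tau(p)$, and the causally-null distance $$\hat d_{d,\tau}(p,q)=\inf\sum_{i=1}^{k}|\tau(p_i)-\tau(p_{i-1})|,$$ the infimum being over all finite sequences $p=p_0,p_1,\dots,p_k=q$ in $X$ such that for each $i$ either $p_i\le_{d,\tau}p_{i-1}$ or $p_{i-1}\le_{d,\tau}p_i$ (and $=\infty$ if there is none). $(X,d,\tau)$ is causally-null if $\hat d_{d,\tau}=d$. *)

(* Defs.v *)
From HB Require Import structures.
From mathcomp Require Import all_boot all_order all_algebra.
From mathcomp Require Import all_classical all_reals all_analysis.
Import Order.TTheory GRing.Theory Num.Theory.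
Import numFieldNormedType.Exports.

Set Implicit Arguments.
Unset Strict Implicit.
Unset Printing Implicit Defensive.

Local Open Scope classical_set_scope.
Local Open Scope ring_scope.

(** * Smooth maps between (finite-dimensional) normed spaces *)

(* Only used for open [U] and finite-dimensional [V], where differentiability
   together with continuity of all directional derivatives is C^1. *)
Fixpoint Ck_on (R : realType) (V W : normedModType R) (k : nat) (U : set V)
    (f : V -> W) : Prop :=
  match k with
  | 0%N => forall x, U x -> {for x, continuous f}
  | k'.+1 => (forall x, U x -> differentiable f x) /\
             (forall v, Ck_on k' U ('D_v f))
  end.

Definition smooth_on (R : realType) (V W : normedModType R) (U : set V)
    (f : V -> W) : Prop := forall k, Ck_on k U f.

(** * Smooth manifolds, tensors and vector fields, in charts *)

(* An atlas with model space [E] on a subset of [X]: the chart [phi i] is only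
   meaningful on [dom i], and its inverse [psi i] only on [phi i @` dom i]. *)
Record atlas (R : realType) (E : normedModType R) (X : topologicalType) :=
  Atlas {
    ix : Type;
    dom : ix -> set X;
    phi : ix -> X -> E;
    psi : ix -> E -> X }.

Section Manifold.
Context {R : realType} {E : normedModType R} {X : topologicalType}.
Implicit Types (S : set X) (A : atlas E X).

Definition transition A (i j : ix A) : E -> E := phi j \o psi i.

(* [S] is an open subset of the Hausdorff, second countable space [X], and [A]
   is a smooth atlas of [S]. *)
Record smooth_manifold S A : Prop := SmoothManifold {
  mfd_hausdorff : hausdorff_space X;
  mfd_second_countable : @second_countable X;
  mfd_cover : \bigcup_i dom (a := A) i = S;
  mfd_dom_open : forall i : ix A, open (dom i);
  mfd_img_open : forall i : ix A, open (phi i @` dom i);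
  mfd_phiK : forall (i : ix A) x, dom i x -> psi i (phi i x) = x;
  mfd_phi_cont : forall (i : ix A) x, dom i x -> {for x, continuous (phi i)};
  mfd_psi_cont : forall (i : ix A) y, (phi i @` dom i) y ->
    {for y, continuous (psi i)};
  mfd_transition : forall i j : ix A,
    smooth_on (phi i @` (dom i `&` dom j)) (transition i j) }.

(* The coefficients of a vector field, resp. a 2-tensor, in the chart [i] at the
   point [x] of [dom i]. *)
Definition vfield A := ix A -> X -> E.
Definition tensor2 A := ix A -> X -> E -> E -> R.

Definition smooth_vfield A (Z : vfield A) : Prop :=
  (forall i j x, dom i x -> dom j x ->
     Z j x = 'd (transition i j) (phi i x) (Z i x)) /\
  (forall i, smooth_on (phi i @` dom i) (Z i \o psi i)).

Definition is_tensor2 A (h : tensor2 A) : Prop :=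
  [/\ forall i x v, dom i x -> scalar (h i x v),
      forall i x w, dom i x -> scalar (fun v => h i x v w) &
      forall i j x v w, dom i x -> dom j x ->
        h i x v w = h j x ('d (transition i j) (phi i x) v)
                          ('d (transition i j) (phi i x) w)].

Definition symmetric_tensor2 A (h : tensor2 A) : Prop :=
  forall i x v w, dom i x -> h i x v w = h i x w v.

Definition smooth_tensor2 A (h : tensor2 A) : Prop :=
  forall i v w, smooth_on (phi i @` dom i) (fun y => h i (psi i y) v w).

Definition riemannian A (h : tensor2 A) : Prop :=
  [/\ is_tensor2 h, symmetric_tensor2 h &
      forall i x v, dom i x -> v != 0 -> 0 < h i x v v].

(** * Spacetimes *)

Definition is_basis (d : nat) (e : 'I_d -> E) : Prop :=
  forall v, exists! c : {ffun 'I_d -> R}, v = \sum_i c i *: e i.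

(* Signature (-,+,...,+), with [n] plus signs. *)
Definition lorentzian_form (n : nat) (B : E -> E -> R) : Prop :=
  exists e : 'I_n.+1 -> E, is_basis e /\
    forall i j, B (e i) (e j) =
      if i == j then (if i == ord0 then -1 else 1) else 0.

Definition lorentzian (n : nat) A (g : tensor2 A) : Prop :=
  [/\ is_tensor2 g, symmetric_tensor2 g, smooth_tensor2 g &
      forall i x, dom i x -> lorentzian_form n (g i x)].

(* A spacetime of dimension [n + 1], time-oriented by the timelike vector
   field [Z]. *)
Definition spacetime (n : nat) S A (g : tensor2 A) (Z : vfield A) : Prop :=
  [/\ smooth_manifold S A, connected S, lorentzian n g, smooth_vfield Z &
      forall i x, dom i x -> g i x (Z i x) (Z i x) < 0].

Definition causal A (g : tensor2 A) (i : ix A) (x : X) (v : E) : Prop :=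
  v != 0 /\ g i x v v <= 0.

Definition future_causal A (g : tensor2 A) (Z : vfield A) i x v : Prop :=
  causal g i x v /\ g i x (Z i x) v < 0.

Definition past_causal A (g : tensor2 A) (Z : vfield A) i x v : Prop :=
  causal g i x v /\ 0 < g i x (Z i x) v.

(* [I] is an open interval on which [alpha] is continuous. *)
Definition smooth_causal A (g : tensor2 A) (Z : vfield A) (I : set R)
    (alpha : R -> X) : Prop :=
  (forall i : ix A, smooth_on (I `&` alpha @^-1` dom i) (phi i \o alpha)) /\
  ((forall i u, I u -> dom i (alpha u) ->
      future_causal g Z i (alpha u) (derive1 (phi i \o alpha) u)) \/
   (forall i u, I u -> dom i (alpha u) ->
      past_causal g Z i (alpha u) (derive1 (phi i \o alpha) u))).

(* The curve is [alpha] restricted to [s 0, s m]; the partition is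
   s 0 < s 1 < ... < s m. *)
Definition piecewise_causal S A (g : tensor2 A) (Z : vfield A)
    (m : nat) (s : nat -> R) (alpha : R -> X) : Prop :=
  [/\ (0 < m)%N,
      forall k, (k < m)%N -> s k < s k.+1,
      {within `[s 0%N, s m], continuous alpha},
      alpha @` `[s 0%N, s m] `<=` S &
      forall k, (k < m)%N -> smooth_causal g Z `]s k, s k.+1[ alpha].

Definition null_length (t : X -> R) (m : nat) (s : nat -> R) (alpha : R -> X)
    : R := \sum_(k < m) `|t (alpha (s k.+1)) - t (alpha (s k))|.

Definition null_distance S A (g : tensor2 A) (Z : vfield A) (t : X -> R)
    (p q : X) : \bar R :=
  ereal_inf [set L | exists m s alpha,
    [/\ piecewise_causal S g Z m s alpha, alpha (s 0%N) = p, alpha (s m) = q &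
        L = (null_length t m s alpha)%:E]].

End Manifold.

(** * Cosmological spacetimes *)

Section Cosmological.
Context {R : realType} {n : nat} {M : topologicalType}.
Variables (T : R) (A : atlas 'rV[R]_n M).

Definition slab : set (R * M) := `]0, T[ `*` setT.

Definition slab_atlas : atlas (R * 'rV[R]_n)%type (R * M)%type :=
  {| ix := ix A;
     dom := fun i => `]0, T[ `*` dom i;
     phi := fun i p => (p.1, phi i p.2);
     psi := fun i y => (y.1, psi i y.2) |}.

Definition partial_t : vfield slab_atlas := fun _ _ => (1, 0).

(* g = - dt^2 + h *)
Definition cosmo_metric (h : tensor2 slab_atlas) : tensor2 slab_atlas :=
  fun i p v w => - (v.1 * w.1) + h i p v w.

Definition cosmological_spacetime (h : tensor2 slab_atlas) : Prop :=
  [/\ is_tensor2 h, symmetric_tensor2 h, smooth_tensor2 h,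
      (forall (i : ix slab_atlas) p v, dom i p ->
         (forall w, h i p v w = 0) <-> exists c : R, v = c *: partial_t i p) &
      spacetime n slab (cosmo_metric h) partial_t].

(* [hbar i (t, x)] is h_t at the point x, in the chart [i] of M, for t in
   [0, T]. *)
Definition extends_continuously (h : tensor2 slab_atlas) : Prop :=
  exists hbar : ix A -> R * M -> 'rV[R]_n -> 'rV[R]_n -> R,
    [/\ forall i p v w, dom (a := slab_atlas) i p ->
          hbar i p v w = h i p (0, v) (0, w),
        forall i v w, {within `[0, T] `*` dom i,
                         continuous (fun p => hbar i p v w)},
        riemannian (A := A) (fun i x => hbar i (0, x)) &
        riemannian (A := A) (fun i x => hbar i (T, x))].

Definition cosmo_null_distance (h : tensor2 slab_atlas) (p q : R * M)
    : \bar R := null_distance slab (cosmo_metric h) partial_t fst p q.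

(* [X], with the isometric embedding [iota], is the metric completion of the
   slab with its null distance, and [tau] extends the time function. The map
   [iota] is only meaningful on [slab]. *)
Definition associated_timed_space (h : tensor2 slab_atlas)
    (X : metricType R) (iota : R * M -> X) (tau : X -> R) : Prop :=
  [/\ forall F : set_system X, ProperFilter F -> cauchy F -> exists x : X, F --> x,
      forall p q, slab p -> slab q ->
        (mdist (iota p) (iota q))%:E = cosmo_null_distance h p q,
      dense (iota @` slab),
      continuous tau &
      forall p, slab p -> tau (iota p) = p.1].

End Cosmological.

(** * Timed metric spaces *)

Section Timed.
Context {R : realType} {X : metricType R}.
Variable tau : X -> R.

Definition timed_metric_space : Prop :=
  (forall p, 0 <= tau p) /\
  (forall p q, `|tau p - tau q| <= mdist p q).

Definition causal_le (p q : X) : Prop := mdist p q = tau q - tau p.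

Definition causally_null_distance (p q : X) : \bar R :=
  ereal_inf [set L | exists (k : nat) (c : nat -> X),
    [/\ c 0%N = p, c k = q,
        forall i, (i < k)%N ->
          causal_le (c i.+1) (c i) \/ causal_le (c i) (c i.+1) &
        L = (\sum_(i < k) `|tau (c i.+1) - tau (c i)|)%:E]].

Definition causally_null : Prop :=
  timed_metric_space /\
  forall p q, causally_null_distance p q = (mdist p q)%:E.

End Timed.

(* Main.v *)
Require Import Defs.
From mathcomp Require Import all_boot all_order all_algebra.
From mathcomp Require Import all_classical all_reals all_analysis.
From mathcomp Require Import zify lra.
Import Order.TTheory GRing.Theory Num.Theory.
Import numFieldNormedType.Exports.

(** In the slab itself the null distance is causally null by construction: a
    smooth causal piece of a curve from [a] to [b] has null length
    [|t b - t a|], while the null distance is never smaller than the difference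
    of times. So the two ends of each piece are related by the causal relation
    of the null distance, and the break points of an almost minimizing curve
    form a chain of almost minimal length ([causal_chain_slab]).

    The content of the theorem is that points added by the completion can be
    joined to points of the slab by causal links of arbitrarily small length
    ([completion_link]). Let [p] be a point of the completion. By compactness of
    [[0, T] x M], the points of the slab whose images tend to [p] accumulate at
    some [(t0, x0)], with [t0 = tau p]. The claim is that [p] is the end of the
    vertical line over [x0], that is [d (p, (s, x0)) = |tau p - s|] for all [s]
    ([completion_vertical_limit]); every [(s, x0)] is then causally linked to
    [p], and [s] may be taken close to [tau p].

    For this it is enough that points of the slab near [(t0, x0)] are uniformly
    close to the vertical line over [x0], even when [t0] is [0] or [T]
    ([near_vertical_line]). Since [h] extends continuously up to [t = t0], it is
    bounded near [(t0, x0)] by [C |w| ^ 2] in a chart, with [C >= 1]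
    ([metric_locally_bounded]). Hence in that chart a straight segment which
    changes time by [d] while moving by at most [d / C] in space is causal: it
    brings a nearby point to the vertical line at the cost of [d]. The segment
    goes up when [t0 < T] and down when [t0 = T], so as to stay in the slab.

    The two explicit curves that are needed, vertical and slanted, are both
    straight segments in one chart; [segment_piecewise_causal] checks once and
    for all that such a segment is a smooth causal curve, which in the other
    charts amounts to the chain rule for a transition map along a line. *)

Set Implicit Arguments.
Unset Strict Implicit.
Unset Printing Implicit Defensive.

Local Open Scope classical_set_scope.
Local Open Scope ring_scope.

(** * Smooth maps along straight lines *)

Section AffineComposition.
Context {R : realType}.
Implicit Types V W : normedModType R.

Definition line V (a v : V) : R -> V := fun u => a + u *: v.

Lemma line_is_diff V (a v : V) u :
  is_diff (u : R) (line a v) ( *:%R^~ v).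
Proof.
have did : differentiable (id : R -> R) u by [].
have dZ : differentiable ((fun z : R => z *: v) : R -> V) u.
  exact: differentiableZl did.
have -> : line a v = cst a + (fun z : R => z *: v) by apply/funext.
apply: DiffDef; first exact: differentiableD.
rewrite diffD// diff_cst (diffZl v did) diff_val.
by apply/funext => z /=; exact: add0r.
Qed.

Lemma line_continuous V (a v : V) : continuous (line a v).
Proof.
move=> u; have dl := line_is_diff a v u; exact: differentiable_continuous.
Qed.

(** Smoothness on an open set only depends on germs: this is what lets an
    induction on the order replace a derivative by a formula that holds on [O]
    alone. *)
Lemma Ck_on_eq V (k : nat) (O : set R) (f g : R -> V) : open O ->
  {in O, f =1 g} -> Ck_on k O f -> Ck_on k O g.
Proof.
elim: k f g => [|k IH] f g oO fg /=.
  move=> cf x Ox; have : f @ x --> f x := cf x Ox.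
  rewrite (fg x) ?inE// => fgx.
  apply: cvg_trans fgx; apply: near_eq_cvg.
  by near=> y; rewrite fg// inE; near: y; exact: (open_nbhs_nbhs (conj oO Ox)).
have nfg x : O x -> {near x, f =1 g}.
  move=> Ox; near=> y; rewrite fg// inE; near: y.
  exact: (open_nbhs_nbhs (conj oO Ox)).
move=> [df cf]; split=> [x Ox|v].
  apply/derivable1_diffP; apply: near_eq_derivable (nfg x Ox) _.
  by apply/derivable1_diffP/df.
apply: (IH _ _ oO _ (cf v)) => x; rewrite inE => Ox.
exact/near_eq_derive/nfg.
Unshelve. all: by end_near. Qed.

Lemma derive_comp_line V W (f : V -> W) (a v : V) (u r : R) :
  differentiable f (line a v u) ->
  'D_r (f \o line a v) u = 'D_(r *: v) f (line a v u).
Proof.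
move=> df; have lu := line_is_diff a v u.
have dl : differentiable (line a v) u by [].
rewrite (deriveE _ df) (deriveE _ (differentiable_comp dl df)).
by rewrite (diff_comp dl df) /= (@diff_val _ _ _ _ _ _ _ lu).
Qed.

(** Directional derivatives commute with restriction to a line, so the case of
    order [k + 1] reduces to the case of order [k] for the directional
    derivatives of [f]. *)
Lemma Ck_on_comp_line V W (k : nat) (U : set V) (O : set R) (f : V -> W)
    (a v : V) :
  open O -> O `<=` line a v @^-1` U -> Ck_on k U f ->
  Ck_on k O (f \o line a v).
Proof.
move=> oO OU; elim: k f => [|k IH] f /=.
  move=> cf x Ox; apply: continuous_comp; first exact: line_continuous.
  exact/cf/OU.
move=> [df cf]; split=> [x Ox|r].
  apply: differentiable_comp; last exact/df/OU.
  by have := line_is_diff a v x.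
apply: (Ck_on_eq oO _ (IH _ (cf (r *: v)))) => x; rewrite inE => Ox.
by rewrite derive_comp_line//; exact/df/OU.
Qed.

End AffineComposition.

(** * Null distance and causal segments in a chart *)

Section CausalSegments.
Context {R : realType} {E : normedModType R} {X : topologicalType}.
Variables (S : set X) (A : atlas E X) (g : tensor2 A) (Z : vfield A).

Lemma tensor2_0r (i : ix A) x v : is_tensor2 g -> dom i x -> g i x v 0 = 0.
Proof.
move=> [+ _ _] dx => /(_ i x v dx (-1) 0 0).
by rewrite scaler0 addr0 mulN1r addNr.
Qed.

(** The null length of a curve with a single piece only sees its two ends. *)
Lemma null_distance_le (t : X -> R) (alpha : R -> X) (s : nat -> R) :
  piecewise_causal S g Z 1 s alpha ->
  (null_distance S g Z t (alpha (s 0%N)) (alpha (s 1%N)) <=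
     `|t (alpha (s 1%N)) - t (alpha (s 0%N))|%:E)%E.
Proof.
move=> h; apply: ereal_inf_lbound; exists 1%N, s, alpha; split=> //.
by rewrite /null_length big_ord1.
Qed.

Lemma piecewise_causal_mono (m : nat) (s : nat -> R) (alpha : R -> X) a b :
  piecewise_causal S g Z m s alpha -> (a <= b <= m)%N -> s a <= s b.
Proof.
move=> [_ smono _ _ _] /andP[ab bm]; move: ab bm; elim: b => [|b IH].
  by rewrite leqn0 => /eqP->.
rewrite leq_eqVlt => /orP[/eqP->//|ab] bm.
exact: le_trans (IH ab (ltnW bm)) (ltW (smono _ bm)).
Qed.

Lemma piecewise_causal_in (m : nat) (s : nat -> R) (alpha : R -> X) k :
  piecewise_causal S g Z m s alpha -> (k <= m)%N -> S (alpha (s k)).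
Proof.
move=> pc km; have [_ _ _ aS _] := pc; apply: aS; exists (s k) => //=.
by rewrite in_itv/= !(piecewise_causal_mono pc)//; lia.
Qed.

Lemma piecewise_causal_piece (m : nat) (s : nat -> R) (alpha : R -> X) k :
  piecewise_causal S g Z m s alpha -> (k < m)%N ->
  piecewise_causal S g Z 1 (fun l => s (k + l)%N) alpha.
Proof.
move=> pc km; have [m0 smono ac aS ap] := pc.
have sub : `[s (k + 0)%N, s (k + 1)%N] `<=` `[s 0%N, s m].
  by apply: subset_itvScc; rewrite ?bnd_simp (piecewise_causal_mono pc)//; lia.
split=> //.
- by move=> [|//] _; rewrite addn0 addn1 smono.
- exact: continuous_subspaceW sub ac.
- by move=> x [u /sub su <-]; apply: aS; exists u.
- by move=> [|//] _; rewrite addn0 addn1; exact: ap.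
Qed.

(** The triangle inequality for the times of the break points. *)
Lemma null_distance_ge (t : X -> R) (p q : X) :
  (`|t q - t p|%:E <= null_distance S g Z t p q)%E.
Proof.
apply: le_ereal_inf_tmp => _ [m [s [alpha [_ <- <- ->]]]].
rewrite lee_fin /null_length -(telescope_sumr (fun k => t (alpha (s k))))//.
by rewrite big_mkord; exact: ler_norm_sum.
Qed.

Hypotheses (hS : smooth_manifold S A) (hg : is_tensor2 g)
  (hZ : smooth_vfield Z).

Lemma tensor2_vfield_transition (i j : ix A) x v : dom i x -> dom j x ->
  g j x (Z j x) ('d (transition i j) (phi i x) v) = g i x (Z i x) v.
Proof.
by move=> dx dy; case: hg => _ _ /(_ i j x _ _ dx dy) ->; rewrite -hZ.1.
Qed.

(** Its pairing with [Z], which is preserved, shows that the image of [v] by the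
    differential of the transition map is not zero. *)
Lemma causal_transition (i j : ix A) x v : dom i x -> dom j x ->
  g i x (Z i x) v != 0 -> causal g i x v ->
  causal g j x ('d (transition i j) (phi i x) v).
Proof.
move=> dx dy gZ [v0 gv]; split; last by case: hg => _ _ /(_ i j x v v dx dy) <-.
apply: contraNneq gZ => v'0; rewrite -(tensor2_vfield_transition _ dx dy) v'0.
by rewrite tensor2_0r.
Qed.

(** In the chart [i] the velocity is the constant [v]. In a chart [j] the curve
    is the transition map along a line, with velocity the image of [v] by the
    differential, so causality and time orientation carry over by the
    transformation laws of [g] and [Z]. *)
Lemma segment_piecewise_causal (i : ix A) (a v : E) (pt := psi i \o line a v) :
  (forall u : R, 0 <= u <= 1 -> (phi i @` dom i) (line a v u)) ->
  (forall u : R, 0 <= u <= 1 -> future_causal g Z i (pt u) v) \/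
  (forall u : R, 0 <= u <= 1 -> past_causal g Z i (pt u) v) ->
  piecewise_causal S g Z 1 (fun k => k%:R) pt.
Proof.
move=> img gv.
have dpt (u : R) : 0 <= u <= 1 -> dom i (pt u).
  by move=> /img[x dx xE]; rewrite /pt /= -xE (mfd_phiK hS).
have phipt (u : R) : 0 <= u <= 1 -> phi i (pt u) = line a v u.
  by move=> /img[x dx xE]; rewrite /pt /= -xE (mfd_phiK hS).
have pt_cont (u : R) : 0 <= u <= 1 -> {for u, continuous pt}.
  move=> u01; apply: continuous_comp; first exact: line_continuous.
  exact: (mfd_psi_cont hS (img _ u01)).
have dsub (u : R) (j : ix A) : 0 <= u <= 1 -> dom j (pt u) ->
    (phi i @` (dom i `&` dom j)) (line a v u).
  by move=> u01 du; exists (pt u); [split=> //; exact: dpt|exact: phipt].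
have oj (j : ix A) : open (`]0 : R, 1[ `&` pt @^-1` dom j).
  rewrite openE => u [] /=; rewrite in_itv/= => /andP[u0 u1] dju.
  apply: filterI; first by apply: near_in_itvoo; rewrite in_itv/= u0.
  have u01 : 0 <= u <= 1 by rewrite (ltW u0) (ltW u1).
  have nj : nbhs (pt u) (dom j).
    by apply: open_nbhs_nbhs; split=> //; exact: (mfd_dom_open hS).
  exact: (pt_cont u u01) nj.
have cl (u : R) : `]0 : R, 1[%classic u -> 0 <= u <= 1.
  by rewrite /= in_itv/= => /andP[u0 u1]; rewrite !ltW.
split=> //.
- by move=> [|//] _; exact: ltr01.
- apply: continuous_in_subspaceT => u; rewrite inE/= in_itv/=.
  exact: pt_cont.
- move=> _ [u + <-]; rewrite /= in_itv/= => u01.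
  by rewrite -(mfd_cover hS); exists i => //; exact: dpt.
move=> [|//] _; split.
  move=> j k; apply: (@Ck_on_comp_line R E E k (phi i @` (dom i `&` dom j)) _
    (transition i j)).
  - exact: oj.
  - by move=> u [/cl u01 du]; exact: dsub.
  - exact: (mfd_transition hS).
have vel (j : ix A) (u : R) : `]0 : R, 1[%classic u -> dom j (pt u) ->
    derive1 (phi j \o pt) u = 'd (transition i j) (phi i (pt u)) v.
  move=> /cl u01 du.
  have dt : differentiable (transition i j) (line a v u).
    by have [+ _] := mfd_transition hS i j 1; apply; exact: dsub.
  rewrite derive1E phipt// -(deriveE _ dt).
  by have := derive_comp_line 1 dt; rewrite scale1r.
case: gv => gv; [left|right] => j u u01 du; rewrite vel//;
  have [cv Zv] := gv u (cl _ u01); have du' := dpt u (cl _ u01).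
- split; last by rewrite tensor2_vfield_transition.
  by apply: causal_transition => //; rewrite lt_eqF.
- split; last by rewrite tensor2_vfield_transition.
  by apply: causal_transition => //; rewrite gt_eqF.
Qed.

End CausalSegments.

(** * Causal segments in a cosmological spacetime *)

Section BilinearBound.
Context {R : realType}.

Lemma scalar_sum (V : lmodType R) (f : V -> R) (J : Type) (r : seq J)
    (c : J -> R) (e : J -> V) : scalar f ->
  f (\sum_(j <- r) c j *: e j) = \sum_(j <- r) c j * f (e j).
Proof.
move=> fl; elim/big_rec2 : _ => [|j y1 y2 _ <-]; last exact: fl.
by have := fl (-1) 0 0; rewrite scaler0 addr0 mulN1r addNr.
Qed.

Lemma ler_norm_coord (n : nat) (w : 'rV[R]_n) a : `|w 0 a| <= `|w|.
Proof.
rewrite [leRHS]/Num.Def.normr /= mx_normrE.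
by apply/bigmax_geP; right; exists (0, a).
Qed.

Lemma ler_bilinear_sum (n : nat) (B : 'rV[R]_n -> 'rV[R]_n -> R)
    (w : 'rV[R]_n) :
  (forall v, scalar (B v)) -> (forall v, scalar (B^~ v)) ->
  B w w <= (\sum_a \sum_b `|B (delta_mx 0 a) (delta_mx 0 b)|) * `|w| ^+ 2.
Proof.
move=> Br Bl; rewrite {1 2}[w]row_sum_delta (scalar_sum _ _ _ (Bl _)).
rewrite mulr_suml ler_sum// => a _; rewrite scalar_sum// mulr_sumr mulr_suml.
rewrite ler_sum// => b _; apply: le_trans (ler_norm _) _.
rewrite !normrM mulrA mulrC ler_wpM2l// expr2.
by rewrite ler_pM// ler_norm_coord.
Qed.

End BilinearBound.

Lemma itvoo_segment (R : realDomainType) (T a b u : R) :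
  0 < a < T -> 0 < b < T -> 0 <= u <= 1 -> 0 < a + u * (b - a) < T.
Proof.
move=> /andP[? ?] /andP[? ?] /andP[? ?].
by have [?|?] := leP a b; apply/andP; split; nra.
Qed.

Section Cosmological.
Context {R : realType} {n : nat} {M : topologicalType}.
Variables (T : R) (A : atlas 'rV[R]_n M) (h : tensor2 (slab_atlas T A)).
Local Notation dt := (@partial_t R n M T A).
Hypothesis hcosmo : cosmological_spacetime h.

(** The time direction spans the radical of [h]. *)
Lemma metric_drop_t (i : ix A) p (s : R) (w : 'rV[R]_n) :
  dom (a := slab_atlas T A) i p -> h i p (s, w) (s, w) = h i p (0, w) (0, w).
Proof.
move=> dp; have [[hr hl _] hsym _ hrad _] := hcosmo.
have ht v : h i p (dt i p) v = 0.
  by apply: (hrad i p (dt i p) dp).2; exists 1; rewrite scale1r.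
have sw : (s, w) = s *: dt i p + (0, w).
  (* Operations on pairs are componentwise by conversion. *)
  transitivity (s * 1 + 0, s *: (0 : 'rV[R]_n) + w) => //.
  by rewrite mulr1 addr0 scaler0 add0r.
rewrite [in LHS]sw.
rewrite (hr _ _ _ dp) (hsym _ _ _ (dt i p) dp) ht mulr0 add0r.
by rewrite (hl _ _ _ dp) ht mulr0 add0r.
Qed.

(** The segment has velocity [(s, w)], for which [g = - s ^ 2 + h (w, w)]. The
    pairing with the time direction is [- s], so the sign of [s] decides between
    future and past. *)
Lemma segment_null_distance (i : ix A) (t s : R) (y w : 'rV[R]_n) : s != 0 ->
  (forall u : R, 0 <= u <= 1 ->
    [/\ 0 < t + u * s < T, (phi i @` dom i) (y + u *: w) &
        h i (t + u * s, psi i (y + u *: w)) (0, w) (0, w) <= s ^+ 2]) ->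
  (cosmo_null_distance h (t, psi i y) (t + s, psi i (y + w))%R <= `|s|%:E)%E.
Proof.
move=> s0 H; have [_ _ _ hrad [hS _ [hg _ _ _] hZ _]] := hcosmo.
pose pt := psi (a := slab_atlas T A) i \o line (t, y) (s, w).
have ptE u : pt u = (t + u * s, psi i (y + u *: w)) by [].
have dpt (u : R) : 0 <= u <= 1 -> dom (a := slab_atlas T A) i (pt u).
  move=> /H[tu [x dx xE] _].
  have dtx : dom (a := slab_atlas T A) i (t + u * s, x).
    by split=> //=; rewrite in_itv.
  have ptx : pt u = (t + u * s, x).
    by have := mfd_phiK hS dtx; rewrite /= xE -ptE.
  by rewrite ptx.
have pc : piecewise_causal (slab T) (cosmo_metric h) dt 1 (fun k => k%:R) pt.
  apply: segment_piecewise_causal => //.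
    move=> v /H[tv [x dx xE] _].
    exists (t + v * s, x); last by rewrite /= xE.
    by split=> //=; rewrite in_itv.
  have gv (u : R) : 0 <= u <= 1 ->
      causal (cosmo_metric h) i (pt u) (s, w).
    move=> u01; split; first by apply: contra_neq s0 => -[].
    rewrite /cosmo_metric metric_drop_t//=; last exact: dpt.
    by have [_ _] := H u u01; rewrite ptE => hs; lra.
  have gZ (u : R) : 0 <= u <= 1 ->
      cosmo_metric h i (pt u) (dt i (pt u)) (s, w) = - s.
    move=> u01; rewrite /cosmo_metric/=.
    rewrite ((hrad i (pt u) (dt i (pt u)) (dpt u u01)).2 _).
      by rewrite addr0 mul1r.
    by exists 1; rewrite scale1r.
  have [sp|sp|] := ltgtP 0 s; [left|right|].
  3: by move=> /esym/eqP; rewrite (negPf s0).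
    by move=> u u01; split; [exact: gv|rewrite gZ// oppr_lt0].
  by move=> u u01; split; [exact: gv|rewrite gZ// oppr_gt0].
have := null_distance_le fst pc.
by rewrite !ptE/= !mul0r !mul1r !scale0r !scale1r !addr0 (addrC t s) addrK.
Qed.

Hypothesis hM : smooth_manifold [set: M] A.

Lemma vertical_null_distance (s s' : R) (x : M) :
  0 < s < T -> 0 < s' < T -> s != s' ->
  (cosmo_null_distance h (s, x) (s', x) <= `|s - s'|%:E)%E.
Proof.
move=> s0T s'0T ss'.
have : (\bigcup_i dom (a := A) i) x by rewrite (mfd_cover hM).
move=> [i _ dx].
have := @segment_null_distance i s (s' - s) (phi i x) 0.
rewrite addr0 (mfd_phiK hM dx) (addrC s) subrK distrC; apply.
  by rewrite subr_eq0 eq_sym.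
move=> u u01; have sT := itvoo_segment s0T s'0T u01.
rewrite scaler0 addr0 (mfd_phiK hM dx); split=> //.
by rewrite tensor2_0r ?sqr_ge0//; case: hcosmo.
Qed.

Hypothesis hext : extends_continuously h.

(** [hbar] bounds the finitely many coefficients of [h] in the chart near
    [(t0, x0)], also from inside the slab when [t0] is an end of [[0, T]]. *)
Lemma metric_locally_bounded (i : ix A) (t0 : R) (x0 : M) :
  0 <= t0 <= T -> dom i x0 ->
  exists2 C : R, 1 <= C & \forall p \near (t0, x0),
    dom (a := slab_atlas T A) i p ->
    forall w, h i p (0, w) (0, w) <= C * `|w| ^+ 2.
Proof.
move=> t0T dx0; have [hbar [hbarE hbarc _ _]] := hext.
have [[hr hl _] _ _ _ _] := hcosmo.
pose e a : 'rV[R]_n := delta_mx 0 a.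
pose C := \sum_a \sum_b (`|hbar i (t0, x0) (e a) (e b)| + 1).
have C0 : 0 <= C.
  by apply: sumr_ge0 => a _; apply: sumr_ge0 => b _; rewrite addr_ge0.
exists (1 + C); first by rewrite lerDl.
pose bounded_at (ab : 'I_n * 'I_n) (p : R * M) := (`[0, T] `*` dom i) p ->
  `|hbar i p (e ab.1) (e ab.2)| <= `|hbar i (t0, x0) (e ab.1) (e ab.2)| + 1.
have near_bounded ab : \forall p \near nbhs (t0, x0), bounded_at ab p.
  case: ab => a b.
  have /subspace_continuousP/(_ (t0, x0)) := hbarc i (e a) (e b).
  move=> /(_ (conj t0T dx0)) /cvgr_norm_le; apply.
  by rewrite ltrDl.
apply: filterS (filter_forall _ near_bounded) => p hp dp w.
have p0T : (`[0, T] `*` dom i) p.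
  case: dp => /=; rewrite !in_itv/= => /andP[/ltW-> /ltW->].
  by split.
have embed0 k (u v : 'rV[R]_n) :
    (0, k *: u + v) = k *: (0, u) + (0, v) :> R * 'rV[R]_n.
  transitivity (k * 0 + 0, k *: u + v) => //.
  by rewrite mulr0 addr0.
pose B v w := h i p (0, v) (0, w).
apply: le_trans (@ler_bilinear_sum _ _ B w _ _) _.
- by move=> v k u1 u2; rewrite /B embed0 (hr _ _ _ dp).
- by move=> v k u1 u2; rewrite /B embed0 (hl _ _ _ dp).
rewrite ler_wpM2r ?sqr_ge0// ler_wpDl//.
apply: ler_sum => a _; apply: ler_sum => b _.
by have := hp (a, b) p0T; rewrite hbarE.
Qed.

(** The slope that makes a segment towards the vertical line causal depends on
    the bound of [metric_locally_bounded] alone, so it does not degenerate at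
    the limit slices [t0 = 0] and [t0 = T]. *)
Lemma near_vertical_line (t0 : R) (x0 : M) (eps : R) :
  0 < T -> 0 <= t0 <= T -> 0 < eps ->
  \forall p \near (t0, x0), slab T p -> exists s : R,
    [/\ 0 < s < T, `|p.1 - s| <= eps &
        (cosmo_null_distance h p (s, x0) <= `|p.1 - s|%:E)%E].
Proof.
move=> T0 t0T eps0.
have : (\bigcup_i dom (a := A) i) x0 by rewrite (mfd_cover hM).
move=> [i _ dx0]; have [C C1 bound] := metric_locally_bounded t0T dx0.
pose y0 : 'rV[R]_n := phi i x0.
have y0img : (phi i @` dom i) y0 by exists x0.
have psi0 : psi i y0 = x0 by exact: (mfd_phiK hM).
have near_img : \forall q \near (t0, y0), (phi i @` dom i) q.2.
  apply: (@cvg_snd _ _ (nbhs t0) (nbhs y0)).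
  by apply: open_nbhs_nbhs; split=> //; exact: (mfd_img_open hM).
have near_bound : \forall q \near (t0, y0),
    dom (a := slab_atlas T A) i (q.1, psi i q.2) ->
    forall w, h i (q.1, psi i q.2) (0, w) (0, w) <= C * `|w| ^+ 2.
  have f : (fun q : R * 'rV[R]_n => (q.1, psi i q.2)) @ nbhs (t0, y0)
      --> nbhs (t0, x0).
    apply: (@cvg_pair _ _ _ _ (nbhs t0) (nbhs x0)); first exact: cvg_fst.
    apply: (@cvg_comp _ _ _ snd (psi i) _ (nbhs y0)); first exact: cvg_snd.
    by rewrite -psi0; exact: (mfd_psi_cont hM y0img).
  exact: f bound.
have [e /= e0 He] := (nbhs_ballP _ _).1 (filterI near_img near_bound).
(* [sg] is the direction of time in which there is room left near [t0], and
   [d1] an upper bound for the time step. *)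
have [sg [d1 [sg1 d10 Hd]]] : exists sg d1 : R, [/\ `|sg| = 1, 0 < d1 &
    forall d t : R, 0 < d < d1 -> `|t - t0| < d -> 0 < t < T ->
      0 < t + sg * d < T].
  move: t0T => /andP[t00 t0T].
  have [t0T'|t0T'] := ltP t0 T.
    exists 1, ((T - t0) / 2); split; [exact: normr1|lra|].
    move=> d t /andP[d0 dd] /ltr_normlP[? ?] /andP[? ?]; rewrite mul1r.
    by apply/andP; split; lra.
  exists (-1), (T / 2); split; [by rewrite normrN normr1|lra|].
  move=> d t /andP[d0 dd] /ltr_normlP[? ?] /andP[? ?]; rewrite mulN1r.
  by apply/andP; split; lra.
(* [d] is both the time step of the segment and the tolerance on the initial
   time; with [d < e / 2] the whole segment stays in the ball of radius [e]. *)
pose d := Num.min (Num.min (e / 2) eps) d1 / 2.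
have [d0 de deps dd1] : [/\ 0 < d, d < e / 2, d <= eps & d < d1].
  have m0 : 0 < Num.min (Num.min (e / 2) eps) d1.
    by rewrite !lt_min d10 eps0 divr_gt0.
  have : Num.min (Num.min (e / 2) eps) d1 <= d1 by rewrite ge_min lexx orbT.
  have : Num.min (Num.min (e / 2) eps) d1 <= eps by rewrite !ge_min lexx orbT.
  have : Num.min (Num.min (e / 2) eps) d1 <= e / 2 by rewrite !ge_min lexx.
  by rewrite /d => *; split; lra.
(* A displacement [w] of norm at most [d / C] has
   [C * |w| ^ 2 <= (C * |w|) ^ 2 <= d ^ 2] as [1 <= C], so the segment is
   causal. *)
pose r := Num.min e (d / C).
have C0 : 0 < C by lra.
have r0 : 0 < r by rewrite lt_min e0 divr_gt0.
have near_x0 : \forall p \near (t0, x0),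
    [/\ `|p.1 - t0| < d, dom i p.2 & `|y0 - phi i p.2| < r].
  have n1 : \forall p \near (t0, x0), `|p.1 - t0| < d.
    apply: (@cvg_fst _ _ (nbhs t0) (nbhs x0) _ [set t | `|t - t0| < d]).
    have := nbhsx_ballx t0 d d0; apply: filterS => t.
    by rewrite -ball_normE/= distrC.
  have n2 : \forall p \near (t0, x0), dom i p.2 /\ `|y0 - phi i p.2| < r.
    apply: (@cvg_snd _ _ (nbhs t0) (nbhs x0) _
      [set x | dom i x /\ `|y0 - phi i x| < r]); apply: filterI.
      by apply: open_nbhs_nbhs; split=> //; exact: (mfd_dom_open hM).
    have phic : phi i @ nbhs x0 --> y0 := mfd_phi_cont hM dx0.
    exact: (cvgr_dist_lt _ _ phic _ r0).
  by apply: filterS2 n1 n2 => p ? [? ?].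
apply: filterS near_x0 => -[t x] [/= td dx xr] [/= + _].
rewrite in_itv/= => t0T'.
pose s := sg * d; have sd : `|s| = d by rewrite normrM sg1 mul1r gtr0_norm.
have ts : 0 < t + s < T by apply: Hd => //; rewrite d0.
exists (t + s); rewrite opprD addNKr normrN sd; split=> //.
pose w := y0 - phi i x.
have xw : phi i x + w = y0 by rewrite addrC subrK.
have := @segment_null_distance i t s (phi i x) w.
rewrite (mfd_phiK hM dx) xw psi0 sd; apply.
  by rewrite -normr_gt0 sd.
move=> u /andP[u0 u1].
have tus : 0 < t + u * s < T.
  have := itvoo_segment t0T' ts; rewrite (addrC t s) addrK; apply.
  by rewrite u0.
pose pu := (t + u * s, psi i (phi i x + u *: w)).
have [/= img bnd] : ((phi i @` dom i) (phi i x + u *: w)) /\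
    (dom (a := slab_atlas T A) i pu ->
     forall w', h i pu (0, w') (0, w') <= C * `|w'| ^+ 2).
  apply: (He (t + u * s, phi i x + u *: w)); split; rewrite -ball_normE/=.
    have -> : t0 - (t + u * s) = (t0 - t) - u * s by lra.
    apply: le_lt_trans (ler_normB _ _) _; rewrite normrM sd distrC ger0_norm//.
    by nra.
  have -> : y0 - (phi i x + u *: w) = (1 - u) *: w.
    by rewrite opprD addrA scalerBl scale1r.
  rewrite normrZ ger0_norm; last lra.
  have wr : `|w| < e by apply: lt_le_trans xr _; rewrite ge_min lexx.
  by have := normr_ge0 w; nra.
split=> //.
have dq : dom (a := slab_atlas T A) i pu.
  split; first by rewrite /= in_itv.
  by rewrite /pu; case: img => z dz <-; rewrite /= (mfd_phiK hM dz).
apply: le_trans (bnd dq w) _.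
have -> : s ^+ 2 = d ^+ 2 by rewrite -sd -normrX ger0_norm// sqr_ge0.
have : `|w| < d / C by apply: lt_le_trans xr _; rewrite ge_min lexx orbT.
rewrite ltr_pdivlMr// => wC.
apply: (@le_trans _ _ ((`|w| * C) ^+ 2)).
  rewrite exprMn mulrC ler_wpM2l ?sqr_ge0// expr2 ler_peMl//; exact: ltW.
by rewrite ler_sqr ?nnegrE; [|apply: mulr_ge0 => //|]; exact: ltW.
Qed.

End Cosmological.

(** * Causal chains in a timed metric space *)

Section CausalChains.
Context {R : realType} {X : metricType R}.
Variable tau : X -> R.

Definition causal_link (p q : X) : Prop :=
  causal_le tau q p \/ causal_le tau p q.

Definition causal_chain (p q : X) (l : R) : Prop :=
  exists (k : nat) (c : nat -> X),
    [/\ c 0%N = p, c k = q,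
        forall i, (i < k)%N -> causal_link (c i) (c i.+1) &
        l = \sum_(i < k) `|tau (c i.+1) - tau (c i)|].

Lemma causal_linkP p q : causal_link p q <-> mdist p q = `|tau q - tau p|.
Proof.
rewrite /causal_link /causal_le (metric_sym q p); split.
  have := mdist_ge0 p q.
  by move=> d0 [dE|dE]; [rewrite distrC|]; rewrite -dE ger0_norm.
by move=> ->; case: (ger0P (tau q - tau p)) => _; [right|left; rewrite opprB].
Qed.

Lemma mdist_le_causal_chain p q l : causal_chain p q l -> mdist p q <= l.
Proof.
move=> [k [c [<- <- clink ->]]]; elim: k clink => [|k IH] clink.
  by rewrite mdistxx big_ord0.
rewrite big_ord_recr/= (le_trans (metric_triangle _ (c k) _))// lerD//.
  by apply: IH => i ik; apply: clink; exact: ltnW.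
by have /causal_linkP-> := clink k (ltnSn k).
Qed.

Lemma causal_chain_cons p p' q l : causal_link p p' -> causal_chain p' q l ->
  causal_chain p q (`|tau p' - tau p| + l).
Proof.
move=> pp' [k [c [c0 ck clink ->]]].
exists k.+1, (fun i => if i is j.+1 then c j else p); split=> //.
  by move=> [_|i]; [rewrite c0|exact: clink].
by rewrite big_ord_recl/= c0.
Qed.

Lemma causal_chain_rcons p q q' l : causal_chain p q' l -> causal_link q' q ->
  causal_chain p q (l + `|tau q - tau q'|).
Proof.
move=> [k [c [c0 ck clink ->]]] qq'.
exists k.+1, (fun i => if (i <= k)%N then c i else q); split=> //.
- by rewrite ltnn.
- move=> i; rewrite ltnS => ik; rewrite ik.
  have [{}ik|ki] := ltnP i k; first exact: clink.
  by have -> : i = k by [lia]; rewrite ck.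
- rewrite big_ord_recr/= leqnn ltnn ck; congr (_ + _).
  by apply: eq_bigr => i _; rewrite ltn_ord ltnW.
Qed.

(** Chains are never shorter than the distance, by the triangle inequality; only
    the existence of almost minimal chains is at stake. *)
Lemma causally_null_distanceE p q :
  (forall e, 0 < e -> exists2 l, l <= mdist p q + e & causal_chain p q l) ->
  causally_null_distance tau p q = (mdist p q)%:E.
Proof.
move=> H; apply/eqP; rewrite eq_le; apply/andP; split.
  apply/lee_addgt0Pr => e e0; have [l le [k [c [c0 ck clink lE]]]] := H e e0.
  apply: (@le_trans _ _ l%:E); last by rewrite -EFinD lee_fin.
  by apply: ereal_inf_lbound; exists k, c; rewrite -lE.
apply: le_ereal_inf_tmp => _ [k [c [c0 ck clink ->]]].
by rewrite lee_fin; apply: mdist_le_causal_chain; exists k, c.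
Qed.

End CausalChains.

Lemma itvoo_approx (R : realFieldType) (T t e : R) :
  0 < T -> 0 <= t <= T -> 0 < e -> exists2 s, 0 < s < T & `|s - t| <= e.
Proof.
move=> T0 /andP[t0 tT] e0; pose d := Num.min e (T / 4).
have d0 : 0 < d by rewrite lt_min e0 divr_gt0.
have de : d <= e by rewrite ge_min lexx.
have dT : d <= T / 4 by rewrite ge_min lexx orbT.
have [tT2|tT2] := leP t (T / 2).
  exists (t + d); first by apply/andP; split; lra.
  by rewrite addrAC subrr add0r gtr0_norm.
exists (t - d); first by apply/andP; split; lra.
by rewrite addrAC subrr add0r normrN gtr0_norm.
Qed.

(** * The completion of the slab *)

Section Completion.
Context {R : realType} {n : nat} {M : topologicalType}.
Variables (T : R) (A : atlas 'rV[R]_n M) (h : tensor2 (slab_atlas T A)).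
Variables (X : metricType R) (iota : R * M -> X) (tau : X -> R).
Hypotheses (T0 : 0 < T) (hM : smooth_manifold [set: M] A)
  (hcompact : compact [set: M]) (hcosmo : cosmological_spacetime h)
  (hext : extends_continuously h)
  (hassoc : associated_timed_space h iota tau).

Lemma mdist_iota_ge p q : slab T p -> slab T q ->
  `|p.1 - q.1| <= mdist (iota p) (iota q).
Proof.
move=> sp sq; have [_ di _ _ _] := hassoc.
by rewrite -lee_fin di// distrC; exact: null_distance_ge.
Qed.

Lemma mdist_iota_vertical (s s' : R) (x : M) : 0 < s < T -> 0 < s' < T ->
  mdist (iota (s, x)) (iota (s', x)) <= `|s - s'|.
Proof.
move=> sT s'T; have [_ di _ _ _] := hassoc.
have [->|ss'] := eqVneq s s'; first by rewrite mdistxx subrr normr0.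
rewrite -lee_fin di; first exact: vertical_null_distance.
  by split; rewrite /= ?in_itv.
by split; rewrite /= ?in_itv.
Qed.

(** Cut an almost minimizing curve at its break points: the piece between two
    of them realizes the difference of times, the least possible distance, so
    consecutive break points are causally linked. *)
Lemma causal_chain_slab p q e : slab T p -> slab T q -> 0 < e ->
  exists2 l, l <= mdist (iota p) (iota q) + e &
    causal_chain tau (iota p) (iota q) l.
Proof.
move=> sp sq e0; have [_ di _ _ taui] := hassoc.
have : (cosmo_null_distance h p q < (mdist (iota p) (iota q) + e)%:E)%E.
  by rewrite -di// lte_fin ltrDl.
move=> /ereal_inf_lt[_ [m [s [alpha [pc ap aq ->]]]] le].
exists (null_length fst m s alpha); first by rewrite ltW// -lte_fin.
have aS k : (k <= m)%N -> slab T (alpha (s k)) := piecewise_causal_in pc.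
exists m, (fun k => iota (alpha (s k))); split; rewrite ?ap ?aq//.
- move=> k km; apply/causal_linkP; rewrite !taui; [|exact/aS/ltnW|exact: aS].
  apply/eqP; rewrite eq_le [in X in _ && X]distrC mdist_iota_ge ?andbT;
    [|exact/aS/ltnW|exact: aS].
  rewrite -lee_fin di; [|exact/aS/ltnW|exact: aS].
  have := null_distance_le fst (piecewise_causal_piece pc km).
  by rewrite addn0 addn1.
- apply: eq_bigr => k _; rewrite !taui//; first exact/aS/ltnW.
  exact: aS.
Qed.

(** [(t0, x0)] is a cluster point in the compact [[0, T] x M] of the trace on
    the slab of the neighborhoods of [p], and [(s, x0)] the point where a
    slanted segment from [q] meets the vertical line. *)
Lemma completion_approx (p : X) : exists t0 x0, 0 <= t0 <= T /\
  forall e : R, 0 < e -> exists q s,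
    [/\ slab T q /\ 0 < s < T, mdist p (iota q) < e, `|tau p - q.1| < e,
        `|t0 - q.1| < e & `|q.1 - s| <= e /\
        mdist (iota q) (iota (s, x0)) <= e].
Proof.
have [_ di dns ctau taui] := hassoc.
pose F := filter_from (nbhs p) (fun U => slab T `&` iota @^-1` U).
have FF : ProperFilter F.
  apply: filter_from_proper; last first.
    move=> U pU; have [] := dns U^°; first by exists p.
      exact: open_interior.
    move=> y [/interior_subset Uq [q sq qE]].
    by exists q; split=> //; rewrite /= qE.
  apply: filter_from_filter; first by exists setT; exact: filterT.
  move=> U V pU pV; exists (U `&` V); first exact: filterI.
  by move=> q [? []].
have KF : F (`[0, T]%classic `*` setT).
  exists setT; first exact: filterT.
  move=> q [[/= + _] _]; rewrite in_itv/= => /andP[/ltW q0 /ltW qT].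
  by split; rewrite //= in_itv/= q0.
have [[t0 x0] [[/= t0T _] cl]] :=
  compact_setX (@segment_compact R 0 T) hcompact FF KF.
rewrite in_itv/= in t0T.
exists t0, x0; split=> // e e0.
have nU : nbhs p (ball p e `&` tau @^-1` ball (tau p) e).
  apply: filterI; first exact: nbhsx_ballx.
  by apply: ctau; exact: nbhsx_ballx.
have nW : nbhs (t0, x0) [set q : R * M | `|t0 - q.1| < e].
  apply: (@cvg_fst _ _ (nbhs t0) (nbhs x0) _ [set t | `|t0 - t| < e]).
  by have := nbhsx_ballx t0 e e0; apply: filterS => t; rewrite -ball_normE.
have FU : F (slab T `&` iota @^-1` (ball p e `&` tau @^-1` ball (tau p) e)).
  by exists (ball p e `&` tau @^-1` ball (tau p) e).
have nV := near_vertical_line hcosmo hM hext x0 T0 t0T e0.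
have [] := cl _ _ FU (filterI nV nW).
move=> q [[sq [pq tq]] [/(_ sq)[s [sT qs dqs]] t0q]].
rewrite ballEmdist/= in pq; rewrite -ball_normE/= taui// in tq.
exists q, s; split=> //; split=> //.
rewrite -lee_fin di//.
by apply: le_trans dqs _; rewrite lee_fin.
Qed.

(** Both inequalities pass to the limit from the slab, where time is 1-Lipschitz
    and vertical lines have null length equal to the difference of times. *)
Lemma completion_vertical_limit (p : X) : exists x0,
  0 <= tau p <= T /\
  forall s, 0 < s < T -> mdist p (iota (s, x0)) = `|tau p - s|.
Proof.
have [t0 [x0 [t0T H]]] := completion_approx p.
have -> : tau p = t0.
  apply/eqP; rewrite -subr_eq0 -normr_le0; apply/ler_addgt0Pl => e e0.
  rewrite addr0; have e20 : 0 < e / 2 by rewrite divr_gt0.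
  have [q [s [_ _ taup t0q _]]] := H _ e20.
  have := ler_distD q.1 (tau p) t0; rewrite [in `|q.1 - t0|]distrC; lra.
exists x0; split=> // s sT; apply/eqP; rewrite eq_le; apply/andP; split.
  apply/ler_addgt0Pr => e e0; have e40 : 0 < e / 4 by rewrite divr_gt0.
  have [q [s1 [[sq s1T] pq _ t0q [qs1 dqs1]]]] := H _ e40.
  have := metric_triangle p (iota q) (iota (s, x0)).
  have := metric_triangle (iota q) (iota (s1, x0)) (iota (s, x0)).
  have := mdist_iota_vertical x0 s1T sT.
  have := ler_distD q.1 s1 s; have := ler_distD t0 q.1 s.
  rewrite [`|s1 - q.1|]distrC [`|q.1 - t0|]distrC; lra.
apply/ler_addgt0Pr => e e0; have e40 : 0 < e / 4 by rewrite divr_gt0.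
have [q [s1 [[sq s1T] pq _ t0q [qs1 dqs1]]]] := H _ e40.
have ss : slab T (s, x0) by split; rewrite //= in_itv.
have := mdist_iota_ge sq ss.
have := metric_triangle (iota q) p (iota (s, x0)).
have := ler_distD q.1 t0 s; rewrite (metric_sym (iota q) p) /=; lra.
Qed.

Lemma completion_link (p : X) (e : R) : 0 < e ->
  exists q, [/\ slab T q, causal_link tau p (iota q) &
    mdist p (iota q) <= e].
Proof.
move=> e0; have [x0 [tauT H]] := completion_vertical_limit p.
have [s sT se] := itvoo_approx T0 tauT e0; have [_ _ _ _ taui] := hassoc.
have ss : slab T (s, x0) by split; rewrite //= in_itv.
exists (s, x0); split=> //; last by rewrite H// distrC.
by apply/causal_linkP; rewrite taui// H// distrC.
Qed.

Lemma completion_timed : timed_metric_space tau.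
Proof.
have [_ _ _ _ taui] := hassoc.
split=> [p|p q]; first by have [x0 [/andP[]]] := completion_vertical_limit p.
apply/ler_addgt0Pr => e e0; have e40 : 0 < e / 4 by rewrite divr_gt0.
have [p' [sp /causal_linkP pp' pe]] := completion_link p e40.
have [q' [sq /causal_linkP qq' qe]] := completion_link q e40.
have pt := pe; have qt := qe.
rewrite pp' taui// distrC in pt; rewrite qq' taui// in qt.
have := mdist_iota_ge sp sq.
have := metric_triangle (iota p') p (iota q').
have := metric_triangle p q (iota q').
have := ler_distD p'.1 (tau p) (tau q); have := ler_distD q'.1 p'.1 (tau q).
rewrite (metric_sym _ p); lra.
Qed.

End Completion.

Theorem theorem1p3 (R : realType) (n : nat) (M : topologicalType)
    (A : atlas 'rV[R]_n M) (T : R) (h : tensor2 (slab_atlas T A))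
    (X : metricType R) (iota : R * M -> X) (tau : X -> R)
    (hT : 0 < T)
    (hM : smooth_manifold [set: M] A)
    (hcompact : compact [set: M])
    (hcosmo : cosmological_spacetime h)
    (hext : extends_continuously h)
    (hassoc : associated_timed_space h iota tau) :
  causally_null tau.
Proof.
have link := completion_link hT hM hcompact hcosmo hext hassoc.
split=> [|p q].
  exact: (completion_timed hT hM hcompact hcosmo hext hassoc).
apply: causally_null_distanceE => e e0.
have e80 : 0 < e / 8 by rewrite divr_gt0.
have [p' [sp pp' pe]] := link p _ e80.
have [q' [sq qq' qe]] := link q _ e80.
have [l le ch] := causal_chain_slab hassoc sp sq e80.
have q'q : causal_link tau (iota q') q by case: qq'; [right|left].
have := causal_chain_rcons (causal_chain_cons pp' ch) q'q.
have /causal_linkP <- := pp'; have /causal_linkP <- := q'q.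
move=> ?; exists (mdist p (iota p') + l + mdist (iota q') q) => //.
have := metric_triangle (iota p') p (iota q').
have := metric_triangle p q (iota q').
rewrite (metric_sym (iota p') p) (metric_sym (iota q') q); lra.
Qed.
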